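(* Let $n\ge 1$ and let $\mathcal O_\mu=\{gH_0g^{-1}: g\in SL(n+1,\mathbb C)\}\subset\mathfrak{sl}(n+1,\mathbb C)$ be the adjoint orbit of $H_0=\mathrm{Diag}(n,-1,\dots,-1)$. For each $j\in\{1,\dots,n+1\}$ the set $D_j=N_j^-N_j^+\cdot H_j\subset\mathcal O_\mu$, which is the domain of the parametrization corresponding to the $j$-th Bruhat cell, is (Zariski) open and dense in $\mathcal O_\mu$.
   Context: $\mathcal O_\mu$ is an affine algebraic variety in $\mathfrak{sl}(n+1,\mathbb C)$. For each index $j$: - $H_j=(1j)\cdot H_0$ is the diagonal matrix with entry $n$ in position $(j,j)$ and all other diagonal entries $-1$ (the image of $H_0$ under the element $(1j)$ of the Weyl group). - $N_j^+\subset SL(n+1,\mathbb C)$ is the subgroup of matrices with $1$'s on the diagonal and whose off-diagonal entries vanish except possibly those in row $j$. - $N_j^-\subset SL(n+1,\mathbb C)$ is the subgroup of matrices with $1$'s on the diagonal and whose off-diagonal entries vanish except possibly those in column $j$. - $N_j^-N_j^+\cdot H_j=\{(yx)H_j(yx)^{-1} : y\in N_j^-,\ x\in N_j^+\}$. *)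

(* Defs.v *)
From HB Require Import structures.
From mathcomp Require Import all_boot all_order all_fingroup all_algebra.
From mathcomp Require Import boolp classical_sets functions reals topology.
From mathcomp.real_closed Require Import complex.
(* The notations of mpoly clash with those of MathComp-Analysis. *)
From mathcomp Require mpoly.
Import (canonicals, coercions) mpoly.

Set Implicit Arguments.
Unset Strict Implicit.
Unset Printing Implicit Defensive.

Import Order.TTheory GRing.Theory Num.Theory.
Local Open Scope classical_set_scope.
Local Open Scope ring_scope.

(* The polynomial functions on m x m matrices are the polynomials in the m * m
   entries, indexed as in [mxvec]. *)
Definition meval_mx (K : fieldType) (m : nat) (A : 'M[K]_m)
    (p : mpoly.mpoly (m * m) K) : K :=
  mpoly.meval (fun k => mxvec A 0 k) p.

Definition zero_locus (K : fieldType) (m : nat)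
    (S : set (mpoly.mpoly (m * m) K)) : set 'M[K]_m :=
  [set A | forall p, S p -> meval_mx A p = 0].

(* An alias of 'M[K]_m, so that the Zariski topology does not compete with the
   entrywise topology of MathComp-Analysis. *)
Definition zariski_mx (K : fieldType) (m : nat) : Type := 'M[K]_m.

HB.instance Definition _ (K : fieldType) (m : nat) :=
  Choice.on (zariski_mx K m).

Section ZariskiTopology.
Variables (K : fieldType) (m : nat).

Definition zariski_open : set_system (zariski_mx K m) :=
  [set U | exists S : set (mpoly.mpoly (m * m) K), U = ~` zero_locus S].

Let zariski_openT : zariski_open setT.
Proof.
exists [set 1]; apply/seteqP; split=> // A _ /(_ 1 erefl).
by move/eqP; rewrite /meval_mx mpoly.meval1 oner_eq0.
Qed.

Let zariski_openI : setI_closed zariski_open.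
Proof.
move=> _ _ [S ->] [T ->].
exists [set r | exists p q, [/\ S p, T q & r = p * q]].
rewrite -setCU; congr (~` _); apply/seteqP; split=> A /=.
  case=> zA _ [p [q [Sp Tq ->]]]; rewrite /meval_mx mpoly.mevalM.
    by rewrite [X in X * _](zA p Sp) mul0r.
  by rewrite [X in _ * X](zA q Tq) mulr0.
move=> zA; apply: contrapT => /not_orP[].
move=> /existsNP[p /not_implyP[Sp pA]] /existsNP[q /not_implyP[Tq qA]].
have /eqP := zA _ (ex_intro _ p (ex_intro _ q (And3 Sp Tq erefl))).
by rewrite /meval_mx mpoly.mevalM mulf_eq0 => /orP[] /eqP.
Qed.

Let zariski_open_bigU (I : Type) (f : I -> set (zariski_mx K m)) :
  (forall i, zariski_open (f i)) -> zariski_open (\bigcup_i f i).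
Proof.
move=> fo; exists [set p | exists i, forall A, ~ f i A -> meval_mx A p = 0].
apply/seteqP; split=> A /=.
  case=> i _; have [S fS] := fo i; rewrite fS => nzA zA; apply: nzA => p Sp.
  apply: zA; exists i => B; rewrite fS => /contrapT; exact.
move=> nzA; apply: contrapT => nfA; apply: nzA => p [i pA].
by apply: pA => fiA; apply: nfA; exists i.
Qed.

HB.instance Definition _ := isOpenTopological.Build (zariski_mx K m)
  zariski_openT zariski_openI zariski_open_bigU.

End ZariskiTopology.

Definition SL (K : fieldType) (m : nat) : set 'M[K]_m := [set g | \det g = 1].
Arguments SL K m : clear implicits.

Definition sl (K : fieldType) (m : nat) : set (zariski_mx K m) :=
  [set A : 'M[K]_m | \tr A = 0].
Arguments sl K m : clear implicits.

Definition Ad (K : fieldType) (n : nat) (g A : 'M[K]_n.+1) :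
  zariski_mx K n.+1 := g * A * g^-1.

(* Indices are shifted: {1, ..., n+1} becomes 'I_n.+1, so H_0 is [Hmx ord0]
   (see [Hmx_tperm] for the action of the transposition (1j)). *)
Definition Hmx (K : fieldType) (n : nat) (j : 'I_n.+1) : 'M[K]_n.+1 :=
  diag_mx (\row_k (if k == j then n%:R else -1)).

Lemma Hmx_tperm (K : fieldType) (n : nat) (j : 'I_n.+1) :
  tperm_mx ord0 j * Hmx K ord0 * (tperm_mx ord0 j)^-1 = Hmx K j.
Proof.
set t : 'M[K]_n.+1 := tperm_mx ord0 j.
have t2 : t * t = 1 by rewrite -[LHS]/(_ *m _) -perm_mxM tperm2 perm_mx1.
have tV : t^-1 = t.
  have tU : t \is a GRing.unit by exact: unitmx_perm.
  by rewrite -[RHS](mulKr tU) t2 mulr1.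
rewrite tV -[LHS]/(_ *m _ *m _).
rewrite -xrowE -xcolE; apply/matrixP=> i k; rewrite !mxE.
rewrite (inj_eq perm_inj); congr (_ *+ _).
by rewrite -(inj_eq (@perm_inj _ (tperm ord0 j))) tpermK tpermL.
Qed.

Definition adjoint_orbit (K : fieldType) (n : nat) : set (zariski_mx K n.+1) :=
  [set Ad g (Hmx K ord0) | g in SL K n.+1].
Arguments adjoint_orbit K n : clear implicits.

Definition Nplus (K : fieldType) (n : nat) (j : 'I_n.+1) : set 'M[K]_n.+1 :=
  [set x | [/\ SL K n.+1 x, forall i, x i i = 1 &
               forall i k, i != k -> i != j -> x i k = 0]].
Arguments Nplus K {n} j.

Definition Nminus (K : fieldType) (n : nat) (j : 'I_n.+1) : set 'M[K]_n.+1 :=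
  [set y | [/\ SL K n.+1 y, forall i, y i i = 1 &
               forall i k, i != k -> k != j -> y i k = 0]].
Arguments Nminus K {n} j.

Definition bruhat_domain (K : fieldType) (n : nat) (j : 'I_n.+1) :
    set (zariski_mx K n.+1) :=
  [set Ad (y * x) (Hmx K j) | y in Nminus K j & x in Nplus K j].
Arguments bruhat_domain K {n} j.

(* Main.v *)
(* Since H_j + 1 = (n + 1) E_jj, every point of the orbit has the form
   A = (n + 1) u v - 1 with u a column, v a row and v u = 1. Such an A lies in
   D_j iff u_j != 0, i.e. iff row j of A + 1 is nonzero, which is an open
   condition. If u_j = 0, choose k with u_k != 0: conjugating A by the
   transvection 1 + t E_jk gives a polynomial curve in the orbit through A that
   lies in D_j for every t != 0, and a polynomial not vanishing at A vanishes
   at finitely many points of this curve only. Hence D_j is dense. *)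
Require Import Defs.
From mathcomp Require Import all_boot all_order all_algebra.
From mathcomp Require Import boolp classical_sets functions reals topology.
From mathcomp.real_closed Require Import complex.
From mathcomp Require mpoly.
Import (canonicals, coercions) mpoly.

Set Implicit Arguments.
Unset Strict Implicit.
Unset Printing Implicit Defensive.

Import Order.TTheory GRing.Theory Num.Theory.
Local Open Scope classical_set_scope.
Local Open Scope ring_scope.

(** * Rank-one form of the orbit and of its cells over a field *)

Section OrbitOverField.
Variables (K : fieldType) (n : nat).
Implicit Types (g x y A : 'M[K]_n.+1) (i j k : 'I_n.+1).
Implicit Types (c u : 'cV[K]_n.+1) (r v : 'rV[K]_n.+1).

Lemma SL_unit g : SL K n.+1 g -> g \in unitmx.
Proof. by rewrite unitmxE => ->; exact: unitr1. Qed.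

Lemma Hmx_delta j : Hmx K j = n.+1%:R *: delta_mx j j - 1%:M.
Proof.
apply/matrixP => i k; rewrite !mxE; case: (eqVneq i k) => [<-|ik].
  by case: eqP => _ /=; rewrite ?mulr1 ?mulr0 ?mulr1n ?sub0r // -natr1 addrK.
rewrite !mulr0n subr0; case: eqP => [ij|_]; last by rewrite mulr0.
by rewrite -ij eq_sym (negPf ik) mulr0.
Qed.

Lemma Ad_Hmx g j : g \in unitmx ->
  Ad g (Hmx K j) = n.+1%:R *: (col j g *m row j (invmx g)) - 1%:M.
Proof.
move=> gU; rewrite /Ad -[LHS]/(g *m Hmx K j *m invmx g) Hmx_delta.
rewrite mulmxBr mulmxBl mulmx1 mulmxV // -scalemxAr -scalemxAl.
by rewrite colE rowE mulmxA -(mulmxA g) mul_delta_mx.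
Qed.

Lemma row_invmx_col g j : g \in unitmx -> row j (invmx g) *m col j g = 1%:M.
Proof.
move=> gU; rewrite colE rowE mulmxA -(mulmxA _ _ g) mulVmx // mulmx1.
by rewrite mul_delta_mx; apply/matrixP => a b; rewrite !ord1 !mxE.
Qed.

Lemma mxtrace_Hmx j : \tr (Hmx K j) = 0.
Proof.
rewrite Hmx_delta mxtraceD mxtraceZ raddfN /= mxtrace1 /mxtrace (bigD1 j) //=.
rewrite big1 => [|k /negPf kj]; last by rewrite mxE kj.
by rewrite mxE !eqxx addr0 mulr1 subrr.
Qed.

Lemma adjoint_orbit_sub_sl : adjoint_orbit K n `<=` sl K n.+1.
Proof.
move=> _ [g gSL <-]; rewrite /sl /= /Ad -[_ * _]/(g *m Hmx K ord0 *m invmx g).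
by rewrite mxtrace_mulC mulmxA mulVmx ?mul1mx ?mxtrace_Hmx ?SL_unit.
Qed.

(** Row j has the single nonzero entry 1, on the diagonal, and the complementary minor is an
    identity matrix because column j has been deleted. *)
Lemma det_col_unipotent y j : (forall i, y i i = 1) ->
  (forall i k, i != k -> k != j -> y i k = 0) -> \det y = 1.
Proof.
move=> y1 y0; rewrite (expand_det_row y j) (bigD1 j) //= big1 => [|k kj].
  rewrite addr0 y1 mul1r /cofactor -signr_odd addnn odd_double expr0 mul1r.
  rewrite (_ : row' j (col' j y) = 1%:M) ?det1 //; apply/matrixP => a b.
  rewrite !mxE; have [->|ab] := eqVneq a b; first by rewrite y1.
  by rewrite y0 ?(inj_eq lift_inj) // eq_sym neq_lift.
by rewrite y0 ?mul0r // eq_sym.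
Qed.

Lemma Nminus_add_col j c : c j 0 = 0 ->
  Nminus K j (1%:M + c *m delta_mx 0 j).
Proof.
move=> cj; have yE i k : (1%:M + c *m delta_mx 0 j) i k =
    (i == k)%:R + c i 0 * (k == j)%:R.
  by rewrite !mxE big_ord1 !mxE eqxx.
have y1 i : (1%:M + c *m delta_mx 0 j) i i = 1.
  rewrite yE eqxx; case: eqP => [->|_]; first by rewrite cj mul0r addr0.
  by rewrite mulr0 addr0.
have y0 i k : i != k -> k != j -> (1%:M + c *m delta_mx 0 j) i k = 0.
  by move=> /negPf ik /negPf kj; rewrite yE ik kj mulr0 addr0.
by split=> //; exact: det_col_unipotent y1 y0.
Qed.

(** Transposition reduces facts about $N_j^+$, the determinant included, to those about $N_j^-$. *)
Lemma Nplus_trmx j x : Nminus K j x^T -> Nplus K j x.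
Proof.
case=> xSL x1 x0; split; first by rewrite /SL /= -det_tr.
  by move=> i; have := x1 i; rewrite mxE.
by move=> i k ik ij; have := x0 k i; rewrite mxE; apply=> //; rewrite eq_sym.
Qed.

Lemma Nplus_add_row j r : r 0 j = 0 ->
  Nplus K j (1%:M + delta_mx j 0 *m r).
Proof.
move=> rj; apply: Nplus_trmx; rewrite linearD /= trmx1 trmx_mul trmx_delta.
by apply: Nminus_add_col; rewrite mxE.
Qed.

(** Row j of y is the j-th unit row. This shows that $u_j = 1$ for the u coming from a point of the
    cell. *)
Lemma NminusM_diag j x y : Nminus K j y -> Nplus K j x -> (y *m x) j j = 1.
Proof.
move=> [_ y1 y0] [_ x1 _]; rewrite mxE (bigD1 j) //= y1 x1 mulr1 big1 ?addr0 //.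
by move=> k kj; rewrite y0 ?mul0r // eq_sym.
Qed.

(* Rescaling column 0 of g makes its determinant 1 and commutes with H_0. *)
Lemma adjoint_orbit_unit g : g \in unitmx -> adjoint_orbit K n (Ad g (Hmx K ord0)).
Proof.
move=> gU; have dg : \det g != 0 by rewrite -unitfE -unitmxE.
pose e : 'rV[K]_n.+1 := \row_k (if k == ord0 then (\det g)^-1 else 1).
have dete : \det (diag_mx e) = (\det g)^-1.
  rewrite det_diag (bigD1 ord0) //= big1 ?mxE ?mulr1 // => k /negPf k0.
  by rewrite mxE k0.
have eU : diag_mx e \in unitmx by rewrite unitmxE dete unitrV unitfE.
exists (g *m diag_mx e); first by rewrite /SL /= det_mulmx dete divff.
rewrite /Ad -[LHS]/(g *m diag_mx e *m Hmx K ord0 *m invmx (g *m diag_mx e)).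
rewrite -[RHS]/(g *m Hmx K ord0 *m invmx g).
have -> : invmx (g *m diag_mx e) = invmx (diag_mx e) *m invmx g.
  exact: (@invrM 'M[K]_n.+1).
rewrite -(mulmxA g) [diag_mx e *m _]diag_mxC !mulmxA.
by rewrite -(mulmxA _ (diag_mx e)) mulmxV // mulmx1.
Qed.

(** The permutation matrix taking $H_0$ to $H_j$ may have determinant -1; [adjoint_orbit_unit]
    allows it as a conjugating factor all the same. *)
Lemma bruhat_domain_sub_orbit j : bruhat_domain K j `<=` adjoint_orbit K n.
Proof.
move=> _ [y [yS _ _] [x [xS _ _] <-]].
have tU : (tperm_mx ord0 j : 'M[K]_n.+1) \in unitmx by exact: unitmx_perm.
have yxU : y * x \in unitmx by rewrite unitmx_mul !SL_unit.
have := @adjoint_orbit_unit (y * x * tperm_mx ord0 j).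
rewrite unitmx_mul yxU tU => /(_ isT); rewrite /Ad -(Hmx_tperm K j).
by rewrite (@invrM 'M[K]_n.+1 (y * x)) // !mulrA.
Qed.

Lemma bruhat_domain_rank1 j u v : v *m u = 1%:M -> u j 0 != 0 ->
  bruhat_domain K j (n.+1%:R *: (u *m v) - 1%:M).
Proof.
move=> vu uj.
(* Rescaling leaves uv unchanged: $u/u_j = e_j + c$ is to be column j of yx, and $w = u_j v$ row j
   of its inverse. The row r is -w with its j-th entry replaced by 0. *)
pose c : 'cV[K]_n.+1 := (u j 0)^-1 *: u - delta_mx j 0.
pose w : 'rV[K]_n.+1 := u j 0 *: v.
pose r : 'rV[K]_n.+1 := w 0 j *: delta_mx 0 j - w.
have cj : c j 0 = 0 by rewrite !mxE !eqxx mulVf // subrr.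
have rj : r 0 j = 0 by rewrite !mxE !eqxx mulr1 subrr.
have yN := Nminus_add_col cj; have xN := Nplus_add_row rj.
set y := 1%:M + _ in yN; set x := 1%:M + _ in xN.
exists y => //; exists x => //.
have [[yS _ _] [xS _ _]] := (yN, xN).
have yxU : y * x \in unitmx by rewrite unitmx_mul !SL_unit.
rewrite Ad_Hmx //.
have dd : delta_mx 0 j *m delta_mx j 0 = 1%:M :> 'M[K]_1.
  by rewrite mul_delta_mx; apply/matrixP => a b; rewrite !ord1 !mxE.
have rd : r *m (delta_mx j 0 : 'cV_n.+1) = 0.
  by rewrite -colE; apply/matrixP => a b; rewrite !ord1 mxE rj mxE.
have colyx : col j (y * x) = (u j 0)^-1 *: u.
  rewrite colE -[y * x]/(y *m x) -mulmxA /x mulmxDl mul1mx -mulmxA rd mulmx0 addr0.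
  by rewrite /y mulmxDl mul1mx -mulmxA dd mulmx1 addrC subrK.
(* Since $wc = vu - w_j = 1 - w_j$, multiplying w by y gives $e_j^T - r$, which x sends to
   $e_j^T$. *)
have wyx : w *m (y *m x) = delta_mx 0 j.
  have wc : w *m c = (1 - w 0 j)%:M.
    rewrite mulmxBr /w -!scalemxAr -!scalemxAl vu scalerA mulVf // scale1r.
    rewrite -colE; apply/matrixP => a b; rewrite !ord1 !mxE /=.
    by rewrite !mulr1n.
  rewrite mulmxA /y mulmxDr mulmx1 mulmxA wc mul_scalar_mx scalerBl scale1r.
  rewrite (_ : w + _ = delta_mx 0 j - r); last by rewrite /r opprB addrCA addrA.
  rewrite /x mulmxDr mulmx1 mulmxA mulmxBl dd rd subr0 mul1mx.
  by rewrite subrK.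
have rowyx : row j (invmx (y * x)) = w.
  by rewrite rowE -wyx -mulmxA mulmxV // mulmx1.
by rewrite colyx rowyx /w -scalemxAl -scalemxAr (scalerA _ (u j 0)) mulVf // scale1r.
Qed.

Lemma Ad_SL_orbit g A : SL K n.+1 g -> adjoint_orbit K n A ->
  adjoint_orbit K n (Ad g A).
Proof.
move=> gS [h hS <-]; exists (g * h).
  by rewrite /SL /= det_mulmx gS hS mulr1.
have gU : g \is a GRing.unit := SL_unit gS.
have hU : h \is a GRing.unit := SL_unit hS.
by rewrite /Ad invrM // !mulrA.
Qed.

Hypothesis n1_neq0 : n.+1%:R != 0 :> K.

(** Row j of A + 1 is $(n+1) u_j v$, and v is nonzero because vu = 1. On the cell $u_j = 1$;
    conversely, for any factorization coming from the orbit, a nonzero entry in row j forces $u_j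
    \neq 0$, and [bruhat_domain_rank1] applies. *)
Lemma bruhat_domainP j A : adjoint_orbit K n A ->
  bruhat_domain K j A <-> exists k, (A + 1%:M) j k != 0.
Proof.
move=> AO; split.
  case=> y yN [x xN AE]; have [[yS _ _] [xS _ _]] := (yN, xN).
  have yxU : y * x \in unitmx by rewrite unitmx_mul !SL_unit.
  have [k vk] : exists k, invmx (y * x) j k != 0.
    apply: contrapT => /forallNP v0.
    have /matrixP/(_ 0 0) := row_invmx_col j yxU.
    rewrite mxE big1 => [|k _]; first by rewrite mxE => /esym/eqP; rewrite oner_eq0.
    by rewrite mxE; have /negP := v0 k; rewrite negbK => /eqP ->; rewrite mul0r.
  exists k; rewrite -AE Ad_Hmx // subrK 2!mxE big_ord1 [col _ _ _ _]mxE.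
  by rewrite [row _ _ _ _]mxE [(y * x) j j](NminusM_diag yN xN) mul1r mulf_neq0.
case: AO => g gS <- [k].
have gU := SL_unit gS; rewrite Ad_Hmx // subrK => uvk.
apply: bruhat_domain_rank1; first exact: row_invmx_col.
by apply: contraNneq uvk => uj; rewrite !mxE big_ord1 uj mul0r mulr0.
Qed.

End OrbitOverField.

(** * Polynomials restricted to a polynomial curve *)

Lemma meval_curve (K : fieldType) (N : nat) (p : mpoly.mpoly N K)
    (f : 'I_N -> {poly K}) :
  exists q : {poly K}, forall t, q.[t] = mpoly.meval (fun k => (f k).[t]) p.
Proof.
exists (\sum_(m <- mpoly.msupp p)
  (mpoly.mcoeff m p)%:P * \prod_(i < N) f i ^+ (m : mpoly.multinom N) i) => t.
rewrite mpoly.mevalE horner_sum; apply: eq_bigr => m _.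
by rewrite hornerM hornerC horner_prod; under eq_bigr do rewrite horner_exp.
Qed.

Lemma poly_neq0_nonroot (K : numFieldType) (q : {poly K}) : q != 0 ->
  exists2 t, t != 0 & q.[t] != 0.
Proof.
move=> q0; apply: contrapT => /forall2NP H.
(* The numbers 1, ..., [size q] are nonzero and distinct in characteristic zero, and too many to be
   all roots of q. *)
have := max_poly_roots (rs := [seq k.+1%:R | k <- iota 0 (size q)]) q0.
rewrite size_map size_iota ltnn => Habs; suff : false by [].
apply: Habs.
  apply/allP => _ /mapP[k _ ->]; have [|/negP] := H k.+1%:R.
    by rewrite pnatr_eq0.
  by rewrite negbK.
rewrite map_inj_uniq ?iota_uniq // => a b /eqP.
by rewrite eqr_nat => /eqP[].
Qed.

(** * Density and openness in characteristic zero *)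

Section OrbitOverNumField.
Variables (K : numFieldType) (n : nat).
Implicit Types (A : zariski_mx K n.+1) (j k : 'I_n.+1).

Lemma adjoint_orbit_neqN1 A : adjoint_orbit K n A ->
  exists k l, (A + 1%:M : 'M[K]_n.+1) k l != 0.
Proof.
case=> g gS <-; have gU := SL_unit gS.
suff /matrix0Pn : Ad g (Hmx K ord0) + 1%:M != 0 :> 'M[K]_n.+1 by [].
apply/eqP; rewrite Ad_Hmx // subrK => /eqP.
rewrite scaler_eq0 pnatr_eq0 /= => /eqP uv0.
(* If uv = 0, then v = (vu)v = 0, against vu = 1. *)
have /(congr1 (mulmx (row ord0 (invmx g)))) := uv0.
rewrite mulmxA row_invmx_col // mul1mx mulmx0 => v0.
have := row_invmx_col ord0 gU; rewrite v0 mul0mx => /matrixP/(_ 0 0)/eqP.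
by rewrite !mxE eq_sym oner_eq0.
Qed.

Lemma transvection_conj_poly A j k (p : mpoly.mpoly (n.+1 * n.+1) K) : j != k ->
  exists q : {poly K}, forall t,
    q.[t] = meval_mx (Ad (1%:M + t *: delta_mx j k) A) p.
Proof.
move=> jk; pose E : 'M[K]_n.+1 := delta_mx j k; pose A' : 'M[K]_n.+1 := A.
(* As $E^2 = 0$, the inverse of 1 + tE is 1 - tE, so the conjugate of A is $A + t(EA - AE) - t^2
   EAE$; [f] lists its entries as polynomials in t. *)
pose f i := (mxvec A' 0 i)%:P + 'X * (mxvec (E *m A' - A' *m E) 0 i)%:P
  - 'X^2 * (mxvec (E *m A' *m E) 0 i)%:P.
have [q qE] := meval_curve p f; exists q => t; rewrite qE /meval_mx.
have EE : E *m E = 0 by rewrite mul_delta_mx_0 // eq_sym.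
have sV : (1%:M + t *: E) *m (1%:M - t *: E) = 1%:M.
  rewrite mulmxBr mulmx1 mulmxDl mul1mx -scalemxAl -scalemxAr EE !scaler0 addr0.
  by rewrite addrK.
have [sU _] := mulmx1_unit sV.
have sE : invmx (1%:M + t *: E) = 1%:M - t *: E.
  by have := mulKmx sU (1%:M - t *: E); rewrite sV mulmx1.
have -> : Ad (1%:M + t *: E) A =
    A' + t *: (E *m A' - A' *m E) - t ^+ 2 *: (E *m A' *m E) :> 'M[K]_n.+1.
  rewrite /Ad -[LHS]/((1%:M + t *: E) *m A' *m invmx (1%:M + t *: E)) sE.
  rewrite mulmxBr mulmx1 !mulmxDl !mul1mx -!scalemxAr -!scalemxAl scalerA.
  by rewrite scalerBr expr2 opprD !addrA addrAC.
congr mpoly.meval; apply: funext => i.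
rewrite /f !hornerE; move: (E *m A' - _) (E *m A' *m E) => B C.
by rewrite raddfB raddfD /= !linearZ !mxE mulrN.
Qed.

Lemma bruhat_domain_dense j A (p : mpoly.mpoly (n.+1 * n.+1) K) :
  adjoint_orbit K n A -> meval_mx A p != 0 ->
  exists B, [/\ adjoint_orbit K n B, bruhat_domain K j B & meval_mx B p != 0].
Proof.
move=> AO pA; have n1 : n.+1%:R != 0 :> K by rewrite pnatr_eq0.
have [DA|nDA] := pselect (bruhat_domain K j A); first by exists A.
have Aj l : (A + 1%:M : 'M[K]_n.+1) j l = 0.
  apply/eqP/negPn/negP => Ajl; apply: nDA.
  by apply/(bruhat_domainP n1 _ AO); exists l.
have [k [l Akl]] := adjoint_orbit_neqN1 AO.
have jk : j != k by apply: contraNneq Akl => <-; rewrite Aj.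
have [q qE] := transvection_conj_poly A p jk.
(* At t = 0 the curve passes through A, where p does not vanish. *)
have q0 : q != 0.
  apply: contraNneq pA => q0; have := qE 0; rewrite q0 horner0 scale0r addr0.
  by rewrite /Ad mul1r invr1 mulr1 => <-.
have [t t0 qt] := poly_neq0_nonroot q0.
pose s : 'M[K]_n.+1 := 1%:M + t *: delta_mx j k.
have sS : SL K n.+1 s.
  (* The transvection lies in $N_k^-$, hence in SL. *)
  have c0 : (t *: delta_mx j 0 : 'cV[K]_n.+1) k 0 = 0.
    by rewrite !mxE eq_sym (negPf jk) mulr0.
  have [+ _ _] := Nminus_add_col c0.
  by rewrite -scalemxAl mul_delta_mx.
have sU := SL_unit sS.
have BO := Ad_SL_orbit sS AO.
exists (Ad s A); split=> //; last by rewrite -qE.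
apply/(bruhat_domainP n1 _ BO); apply: contrapT => /forallNP Bj.
(* With B the conjugate of A by s, compare the (j, l) entries of (B + 1)s = s(A + 1): the left one
   is 0 if row j of B + 1 is, while the right one is $t (A + 1)_{kl} \neq 0$, as row j of A + 1
   vanishes. *)
have Bs : (Ad s A + 1%:M : 'M[K]_n.+1) *m s = s *m (A + 1%:M : 'M[K]_n.+1).
  rewrite mulmxDl [RHS]mulmxDr mul1mx mulmx1; congr (_ + _).
  exact: mulmxKV.
have /matrixP/(_ j l) := Bs; rewrite mxE big1 => [|i _]; last first.
  by have /negP := Bj i; rewrite negbK => /eqP ->; rewrite mul0r.
move/eqP; rewrite eq_sym mulmxDl mul1mx mxE Aj add0r -scalemxAl mxE.
rewrite -(mul_delta_mx (0 : 'I_1)) -mulmxA -rowE mxE big_ord1 !mxE eqxx mul1r.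
by rewrite mulf_eq0 (negPf t0); move: Akl; rewrite !mxE => /negPf ->.
Qed.

Lemma open_row_neqN1 j :
  open ([set A | exists k, (A + 1%:M : 'M[K]_n.+1) j k != 0] :
    set (zariski_mx K n.+1)).
Proof.
pose P k : mpoly.mpoly (n.+1 * n.+1) K :=
  mpoly.mpolyX K (mpoly.mnm1 (mxvec_index j k)) + mpoly.mpolyC _ (j == k)%:R.
have PE A k : meval_mx A (P k) = (A + 1%:M : 'M[K]_n.+1) j k.
  by rewrite /meval_mx mpoly.mevalD mpoly.mevalXU mpoly.mevalC mxvecE !mxE.
exists (range P); apply/seteqP; split=> A /=.
  by case=> k Ak zA; move: Ak; rewrite -PE zA ?eqxx //; exists k.
move=> nzA; apply: contrapT => /forallNP A0; apply: nzA => _ [k _ <-].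
by rewrite PE; apply/eqP/negPn/negP; exact: A0.
Qed.

End OrbitOverNumField.

(* [adjoint_orbit R[i] n], used as a type, carries the subspace topology. *)
Theorem corollary5p4 (R : realType) (n : nat) (hn : (1 <= n)%N) :
  adjoint_orbit R[i] n `<=` sl R[i] n.+1 /\
  forall j : 'I_n.+1,
    let D := bruhat_domain R[i] j in
    let D_in_orbit : set (adjoint_orbit R[i] n) := set_val @^-1` D in
    [/\ D `<=` adjoint_orbit R[i] n, open D_in_orbit & dense D_in_orbit].
Proof.
split=> [|j D DO]; first exact: adjoint_orbit_sub_sl.
have n1 : n.+1%:R != 0 :> R[i] by rewrite pnatr_eq0.
split; first exact: bruhat_domain_sub_orbit.
  (* This set is open among all matrices; it agrees with D only on the orbit. *)
  exists [set A | exists k, (A + 1%:M : 'M[R[i]]_n.+1) j k != 0].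
    exact: open_row_neqN1.
  apply/seteqP; split=> A /= HA; apply/(bruhat_domainP n1 j (set_valP A)); exact: HA.
move=> O [A OA] [W [S WE] WO].
have : W (set_val A) by rewrite -[W _]/((set_val @^-1` W) A) WO.
(* W is the complement of a zero locus, so some p in S is nonzero at A; any B with $p(B) \neq 0$
   stays in W. *)
rewrite WE => /existsNP[p /not_implyP[Sp /eqP pA]].
have [B [BO DB pB]] := bruhat_domain_dense j (set_valP A) pA.
exists (SigSub (mem_set BO)); split=> //; rewrite -WO /= WE => zB.
by move: pB; rewrite zB // eqxx.
Qed.
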